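(* Let $\mathbf{C}$ be a small category with countably many arrows, $O$ a set of observations and $T$ an inference system. Let $F_{\mathbf{H}}$ and $F_{\mathbf{S}_T}$ be final objects of $\mathbf{Coalg}_{\mathbf{H}}$ and $\mathbf{Coalg}_{\mathbf{S}_T}$ respectively. Let $\langle\mathbb{X},\alpha\rangle$ be an $\mathbf{S}_T$-coalgebra, let $!^{\mathbf{S}_T}$ be the unique $\mathbf{S}_T$-coalgebra morphism from $\langle\mathbb{X},\alpha\rangle$ to $F_{\mathbf{S}_T}$, and let $!^{\mathbf{H}}$ be the unique $\mathbf{H}$-coalgebra morphism to $F_{\mathbf{H}}$ from $\langle\mathbb{X},\alpha\rangle$ regarded as the $\mathbf{H}$-coalgebra $\langle\mathbb{X},\alpha;\iota_{\mathbb{X}}\rangle$, where $\iota_{\mathbb{X}}:\mathbf{S}_T(\mathbb{X})\to\mathbf{H}(\mathbb{X})$ is the inclusion. Then for all $x,y$ (of the same sort) in $\mathbb{X}$, $!^{\mathbf{H}}(x)=\,!^{\mathbf{H}}(y)$ if and only if $!^{\mathbf{S}_T}(x)=\,!^{\mathbf{S}_T}(y)$.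
   Context: Composition is written in diagrammatic order: $f;g$ means first $f$, then $g$. $|\mathbf{C}|$ is the set of objects and $\|\mathbf{C}\|$ the set of arrows of $\mathbf{C}$. A $\Gamma(\mathbf{C})$-algebra $\mathbb{X}$ is a family of sets $X=(X_i)_{i\in|\mathbf{C}|}$ with a function $c_{\mathbb{X}}:X_i\to X_j$ for every $c\in\mathbf{C}[i,j]$ such that $(id_i)_{\mathbb{X}}=id_{X_i}$ and $(d;e)_{\mathbb{X}}(x)=e_{\mathbb{X}}(d_{\mathbb{X}}(x))$ (i.e. a functor $\mathbf{C}\to\mathbf{Set}$). Homomorphisms are natural transformations; the category is $\mathbf{Alg}_{\Gamma(\mathbf{C})}$. $\int X=\sum_{i}X_i$. $\mathbf{G}(X)_i$ is the set of (at most) countable subsets of $\sum_{j\in|\mathbf{C}|}\mathbf{C}[i,j]\times O\times\int X$. The endofunctor $\mathbf{H}$ of $\mathbf{Alg}_{\Gamma(\mathbf{C})}$ maps $\mathbb{X}$ to the algebra with carrier $(\mathbf{G}(X)_i)_i$ and, for $d\in\mathbf{C}[i,k]$, $d_{\mathbf{H}(\mathbb{X})}(A)=\{(c_2,o,x)\mid (c_1,o,x)\in A,\ c_1=d;c_2\}$; on arrows $\mathbf{H}(h)(A)=\{(c,o,h(x))\mid(c,o,x)\in A\}$. An inference system $T$ is a set of rules $c\xrightarrow[o']{o}d$ with $c\in\mathbf{C}[i,i']$, $d\in\mathbf{C}[j,j']$, $o,o'\in O$. $\Phi(T)$ is the closure of $T$ together with all identity rules $id_i\xrightarrow[o]{o}id_j$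 ($i,j\in|\mathbf{C}|$, $o\in O$) under: $c\xrightarrow[o']{o}c'$ and $d\xrightarrow[o'']{o'}d'$ give $c;d\xrightarrow[o'']{o}c';d'$ whenever $c;d$ and $c';d'$ are defined. For $d\in\mathbf{C}[i,k]$, $c_1$ of source $i$ and $c_2$ of source $k$, write $(c_1,o_1,q_1)\vdash^{d}_{T,\mathbb{X}}(c_2,o_2,q_2)$ iff there are $e,e'\in\|\mathbf{C}\|$ with $c_1;e=d;c_2$, $e\xrightarrow[o_2]{o_1}e'\in\Phi(T)$ and $e'_{\mathbb{X}}(q_1)=q_2$. Write $\vdash_{T,\mathbb{X}}$ for $\vdash^{id}_{T,\mathbb{X}}$. $A\in\mathbf{G}(X)_i$ is saturated if closed under $\vdash_{T,\mathbb{X}}$. The endofunctor $\mathbf{S}_T$ maps $\mathbb{X}$ to the algebra whose carrier of sort $i$ is the set of saturated sets in $\mathbf{G}(X)_i$, with $d_{\mathbf{S}_T(\mathbb{X})}(A)=\{t_2\mid \exists t_1\in A,\ t_1\vdash^{d}_{T,\mathbb{X}}t_2\}$; on arrows it acts as $\mathbf{H}$. For an endofunctor $\mathbf{B}$, a $\mathbf{B}$-coalgebra is a pair $\langle\mathbb{X},\alpha:\mathbb{X}\to\mathbf{B}(\mathbb{X})\rangle$; a morphism $\langle\mathbb{X},\alpha\rangle\to\langle\mathbb{Y},\beta\rangle$ is a homomorphism $f$ with $\alpha;\mathbf{B}(f)=f;\beta$. Both $\mathbf{Coalg}_{\mathbf{H}}$ and $\mathbf{Coalg}_{\mathbf{S}_T}$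 have final objects. *)

(* Defs.v *)
From mathcomp Require Import all_boot.
From mathcomp Require Import boolp classical_sets functions cardinality.

Set Implicit Arguments.
Unset Strict Implicit.
Unset Printing Implicit Defensive.

Local Open Scope classical_set_scope.

Lemma existT_inj_snd (I : Type) (P : I -> Type) (i : I) (x y : P i) :
  existT P i x = existT P i y -> x = y.
Proof.
move=> e; pose F (u : {i : I & P i}) (h : projT1 u = i) : P i :=
  ecast j (P j) h (projT2 u).
suff H u (h : projT1 u = i) : u = existT P i y -> F u h = y.
  by have := H (existT P i x) erefl e.
by move=> eu; subst u; rewrite /F (Prop_irrelevance h erefl).
Qed.

Declare Scope cat_scope.
Delimit Scope cat_scope with cat.
Local Open Scope cat_scope.

Record category := Category {
  obj :> Type;
  arr : obj -> obj -> Type;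
  idc : forall i, arr i i;
  compc : forall i j k, arr i j -> arr j k -> arr i k;
  comp_idl : forall i j (c : arr i j), compc (idc i) c = c;
  comp_idr : forall i j (c : arr i j), compc c (idc j) = c;
  comp_assoc : forall i j k l (c : arr i j) (d : arr j k) (e : arr k l),
    compc c (compc d e) = compc (compc c d) e }.
Arguments arr {_} i j.
Arguments idc {_} i.

(* Composition is in diagrammatic order: first c, then d. *)
Notation "c ;; d" := (compc c d) (at level 50, left associativity) : cat_scope.

Definition arrows (C : category) : Type := {i : C & {j : C & arr i j}}.

Record alg (C : category) := Alg {
  carrier :> C -> Type;
  act : forall i j, arr i j -> carrier i -> carrier j;
  act_id : forall i (x : carrier i), act (idc i) x = x;
  act_comp : forall i j k (d : arr i j) (e : arr j k) (x : carrier i),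
    act (d ;; e) x = act e (act d x) }.
Arguments act {C} _ {i j} c x.

Record alg_hom (C : category) (X Y : alg C) := AlgHom {
  hom_fun :> forall i, X i -> Y i;
  hom_act : forall i j (c : arr i j) (x : X i),
    hom_fun (act X c x) = act Y c (hom_fun x) }.
Arguments hom_fun {C X Y} _ i x.

Lemma alg_hom_eq (C : category) (X Y : alg C) (f g : alg_hom X Y) :
  (forall i x, f i x = g i x) -> f = g.
Proof.
case: f g => [f fP] [g gP] /= fg.
have E : f = g.
  by apply: functional_extensionality_dep => i; apply: funext => x.
by case: _ / E gP => gP; rewrite (Prop_irrelevance fP gP).
Qed.

Definition alg_id (C : category) (X : alg C) : alg_hom X X :=
  @AlgHom C X X (fun i x => x) (fun i j c x => erefl).

Lemma alg_comp_act (C : category) (X Y Z : alg C) (f : alg_hom X Y)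
    (g : alg_hom Y Z) i j (c : arr i j) (x : X i) :
  g j (f j (act X c x)) = act Z c (g i (f i x)).
Proof. by rewrite !hom_act. Qed.

Definition alg_comp (C : category) (X Y Z : alg C) (f : alg_hom X Y)
    (g : alg_hom Y Z) : alg_hom X Z :=
  @AlgHom C X Z (fun i x => g i (f i x)) (alg_comp_act f g).

Record endofunctor (C : category) := Endofunctor {
  fobj :> alg C -> alg C;
  fmap : forall X Y : alg C, alg_hom X Y -> alg_hom (fobj X) (fobj Y);
  fmap_id : forall X : alg C, fmap (alg_id X) = alg_id (fobj X);
  fmap_comp : forall (X Y Z : alg C) (f : alg_hom X Y) (g : alg_hom Y Z),
    fmap (alg_comp f g) = alg_comp (fmap f) (fmap g) }.
Arguments fmap {C} _ {X Y} f.

Record coalg (C : category) (B : endofunctor C) := Coalg {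
  coalg_alg :> alg C;
  coalg_str : alg_hom coalg_alg (B coalg_alg) }.
Arguments Coalg {C B} coalg_alg coalg_str.
Arguments coalg_str {C B} _.

Record coalg_hom (C : category) (B : endofunctor C) (X Y : coalg B) :=
  CoalgHom {
    coalg_fun :> alg_hom X Y;
    coalg_hom_comm : alg_comp (coalg_str X) (fmap B coalg_fun)
                   = alg_comp coalg_fun (coalg_str Y) }.

Definition final_coalg (C : category) (B : endofunctor C) (F : coalg B) : Prop :=
  forall X : coalg B, exists f : coalg_hom X F,
    forall g : coalg_hom X F, g = f.

Record int_sum (C : category) (X : C -> Type) := IntSum {
  srt : C;
  elt : X srt }.

(* Elements (c, o, q) of sum_j C[i,j] x O x (sum_k X_k); the target j of the
   arrow and the sort k of the element are unrelated. *)
Record triple (C : category) (O : Type) (X : C -> Type) (i : C) := Triple {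
  tgt : C;
  tarr : arr i tgt;
  tobs : O;
  tstate : int_sum X }.
Arguments Triple {C O X i tgt} tarr tobs tstate.

Record gset (C : category) (O : Type) (X : C -> Type) (i : C) := GSet {
  gset_set :> set (triple O X i);
  gset_countable : countable gset_set }.
Arguments GSet {C O X i} gset_set gset_countable.

Lemma gset_eq (C : category) (O : Type) (X : C -> Type) (i : C)
  (A B : gset O X i) : gset_set A = gset_set B -> A = B.
Proof.
case: A B => [A cA] [B cB] /= AB; case: _ / AB cB => cB.
by rewrite (Prop_irrelevance cA cB).
Qed.

Section Hfunctor.
Variables (C : category) (hC : countable [set: arrows C]) (O : Type).

Definition Hset (X : C -> Type) (i k : C) (d : arr i k)
    (A : set (triple O X i)) : set (triple O X k) :=
  [set t | A (Triple (d ;; tarr t) (tobs t) (tstate t))].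

Lemma Hset_countable (X : C -> Type) (i k : C) (d : arr i k)
  (A : set (triple O X i)) : countable A -> countable (Hset d A).
Proof.
move=> cA.
pose B (a : arrows C) (t1 : triple O X i) : set (triple O X k) :=
  [set t | existT _ k (existT _ (tgt t) (tarr t)) = a :> arrows C /\
           tobs t = tobs t1 /\ tstate t = tstate t1].
have BE : Hset d A `<=` \bigcup_(a in [set: arrows C]) \bigcup_(t in A) B a t.
  by move=> t At; exists (existT _ k (existT _ (tgt t) (tarr t))) => //;
    exists (Triple (d ;; tarr t) (tobs t) (tstate t)).
apply: sub_countable (subset_card_le BE) _.
apply: bigcup_countable => // a _; apply: bigcup_countable => // t1 _.
apply/countable_injP; exists (fun=> 0) => t t'; rewrite !inE.
case=> e [eo ev] [e' [eo' ev']] _.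
case: t t' e eo ev e' eo' ev' => [j c o q] [j' c' o' q'] /= <- -> -> e' -> ->.
pose mk (u : {l : C & arr k l}) : triple O X k :=
  Triple (projT2 u) (tobs t1) (tstate t1).
exact: (congr1 mk (esym (existT_inj_snd e'))).
Qed.

Lemma Hset_id (X : C -> Type) (i : C) (A : set (triple O X i)) :
  Hset (idc i) A = A.
Proof. by apply/funext => -[j c o q]; rewrite /Hset /= comp_idl. Qed.

Lemma Hset_comp (X : C -> Type) (i j k : C) (d : arr i j) (e : arr j k)
    (A : set (triple O X i)) : Hset (d ;; e) A = Hset e (Hset d A).
Proof. by apply/funext => -[l c o q]; rewrite /Hset /= comp_assoc. Qed.

Definition Hact (X : C -> Type) (i k : C) (d : arr i k) (A : gset O X i) :
    gset O X k :=
  GSet (Hset d A) (Hset_countable d (gset_countable A)).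

Lemma Hact_id (X : C -> Type) (i : C) (A : gset O X i) : Hact (idc i) A = A.
Proof. by apply: gset_eq; exact: Hset_id. Qed.

Lemma Hact_comp (X : C -> Type) (i j k : C) (d : arr i j) (e : arr j k)
    (A : gset O X i) : Hact (d ;; e) A = Hact e (Hact d A).
Proof. by apply: gset_eq; exact: Hset_comp. Qed.

Definition Halg (X : alg C) : alg C :=
  @Alg C (gset O X) (@Hact X) (@Hact_id X) (@Hact_comp X).

Definition map_triple (X Y : C -> Type) (h : forall i, X i -> Y i) (i : C)
    (t : triple O X i) : triple O Y i :=
  Triple (tarr t) (tobs t) (IntSum (h _ (elt (tstate t)))).

Definition Hmap (X Y : C -> Type) (h : forall i, X i -> Y i) (i : C)
    (A : gset O X i) : gset O Y i :=
  GSet (map_triple h (i := i) @` A)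
    (sub_countable (card_image_le _ _) (gset_countable A)).

Lemma Hset_map (X Y : C -> Type) (h : forall i, X i -> Y i) (i k : C)
    (d : arr i k) (A : set (triple O X i)) :
  map_triple h (i := k) @` (Hset d A) = Hset d (map_triple h (i := i) @` A).
Proof.
apply/seteqP; split=> [t2 [t1 At1 <-]|[j c o q] [[j1 c1 o1 q1] At1]].
  by exists (Triple (d ;; tarr t1) (tobs t1) (tstate t1)).
rewrite /map_triple /= => -[ej].
case: _ / ej c => c e <- <-.
have ec := existT_inj_snd e.
by exists (Triple c o1 q1) => //; rewrite /Hset /= -ec.
Qed.

Lemma Hmap_act (X Y : C -> Type) (h : forall i, X i -> Y i) (i k : C)
    (d : arr i k) (A : gset O X i) : Hmap h (Hact d A) = Hact d (Hmap h A).
Proof. by apply: gset_eq; exact: Hset_map. Qed.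

Definition Hhom (X Y : alg C) (h : alg_hom X Y) : alg_hom (Halg X) (Halg Y) :=
  @AlgHom C (Halg X) (Halg Y) (@Hmap X Y h) (@Hmap_act X Y h).

Lemma map_triple_id (X : C -> Type) (i : C) (A : set (triple O X i)) :
  map_triple (fun k (x : X k) => x) (i := i) @` A = A.
Proof.
apply/seteqP; split=> [_ [[j c o [k x]] At <-] //|[j c o [k x]] At].
by exists (Triple c o (IntSum x)).
Qed.

Lemma map_triple_comp (X Y Z : C -> Type) (f : forall i, X i -> Y i)
    (g : forall i, Y i -> Z i) (i : C) (A : set (triple O X i)) :
  map_triple (fun k x => g k (f k x)) (i := i) @` A
  = map_triple g (i := i) @` (map_triple f (i := i) @` A).
Proof. by rewrite image_comp. Qed.

Lemma Hhom_id (X : alg C) : Hhom (alg_id X) = alg_id (Halg X).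
Proof. by apply: alg_hom_eq => i A; apply: gset_eq; exact: map_triple_id. Qed.

Lemma Hhom_comp (X Y Z : alg C) (f : alg_hom X Y) (g : alg_hom Y Z) :
  Hhom (alg_comp f g) = alg_comp (Hhom f) (Hhom g).
Proof. by apply: alg_hom_eq => i A; apply: gset_eq; exact: map_triple_comp. Qed.

Definition Hfun : endofunctor C := Endofunctor Hhom_id Hhom_comp.

End Hfunctor.
Arguments Hfun {C} hC O.

(* T c o o' d is the rule with source c, target d, and label o above o'. *)
Definition inference_system (C : category) (O : Type) : Type :=
  forall i i' j j' : C, arr i i' -> O -> O -> arr j j' -> Prop.

Inductive Phi (C : category) (O : Type) (T : inference_system C O) :
    forall i i' j j' : C, arr i i' -> O -> O -> arr j j' -> Prop :=
| Phi_rule i i' j j' (c : arr i i') (o o' : O) (d : arr j j') :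
    @T i i' j j' c o o' d -> Phi T c o o' d
| Phi_id (i j : C) (o : O) : Phi T (idc i) o o (idc j)
| Phi_comp i i' i'' j j' j'' (c : arr i i') (d : arr i' i'')
    (c' : arr j j') (d' : arr j' j'') (o o' o'' : O) :
    Phi T c o o' c' -> Phi T d o' o'' d' ->
    Phi T (c ;; d) o o'' (c' ;; d').

(* The types record that the composites c1;e and d;c2 have the same target and
   that e' goes from the sort of q1 to the sort of q2. *)
Definition entails (C : category) (O : Type) (T : inference_system C O)
    (X : alg C) (i k : C) (d : arr i k)
    (t1 : triple O X i) (t2 : triple O X k) : Prop :=
  exists (e : arr (tgt t1) (tgt t2))
         (e' : arr (srt (tstate t1)) (srt (tstate t2))),
    [/\ tarr t1 ;; e = d ;; tarr t2,
        Phi T e (tobs t1) (tobs t2) e' &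
        act X e' (elt (tstate t1)) = elt (tstate t2)].

Definition saturated (C : category) (O : Type) (T : inference_system C O)
    (X : alg C) (i : C) (A : set (triple O X i)) : Prop :=
  forall t1 t2, A t1 -> entails T (idc i) t1 t2 -> A t2.

Record satset (C : category) (O : Type) (T : inference_system C O)
    (X : alg C) (i : C) := SatSet {
  satset_gset :> gset O X i;
  satset_saturated : saturated T satset_gset }.
Arguments SatSet {C O T X i} satset_gset satset_saturated.

Lemma satset_eq (C : category) (O : Type) (T : inference_system C O)
    (X : alg C) (i : C) (A B : satset T X i) :
  gset_set A = gset_set B -> A = B.
Proof.
move=> /gset_eq; case: A B => [A sA] [B sB] /= AB; case: _ / AB sB => sB.
by rewrite (Prop_irrelevance sA sB).
Qed.

Section Sfunctor.
Variables (C : category) (hC : countable [set: arrows C]) (O : Type).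
Variable T : inference_system C O.

Definition Sset (X : alg C) (i k : C) (d : arr i k)
    (A : set (triple O X i)) : set (triple O X k) :=
  [set t2 | exists2 t1, A t1 & entails T d t1 t2].

Lemma Sset_Hset (X : alg C) (i k : C) (d : arr i k)
    (A : set (triple O X i)) : saturated T A -> Sset d A = Hset d A.
Proof.
move=> sA; apply/seteqP; split=> [t2 [t1 At1 [e [e' [E P Q]]]]|t2 At2].
  by apply: sA At1 _; exists e, e'; split=> //=; rewrite comp_idl.
exists (Triple (d ;; tarr t2) (tobs t2) (tstate t2)) => //.
by exists (idc _), (idc _); split; rewrite ?comp_idr ?act_id//; exact: Phi_id.
Qed.

Lemma Hset_saturated (X : alg C) (i k : C) (d : arr i k)
    (A : set (triple O X i)) : saturated T A -> saturated T (Hset d A).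
Proof.
move=> sA t1 t2 At1 [e [e' [E P Q]]]; apply: sA At1 _.
by exists e, e'; split=> //=; rewrite comp_idl -comp_assoc E comp_idl.
Qed.

Lemma Sset_countable (X : alg C) (i k : C) (d : arr i k) (A : satset T X i) :
  countable (Sset d A).
Proof.
rewrite (Sset_Hset _ (satset_saturated (s := A))).
exact: Hset_countable (gset_countable A).
Qed.

Lemma Sset_saturated (X : alg C) (i k : C) (d : arr i k) (A : satset T X i) :
  saturated T (Sset d A).
Proof.
rewrite (Sset_Hset _ (satset_saturated (s := A))).
exact: Hset_saturated (satset_saturated (s := A)).
Qed.

Definition Sact (X : alg C) (i k : C) (d : arr i k) (A : satset T X i) :
    satset T X k :=
  SatSet (GSet (Sset d A) (@Sset_countable X i k d A)) (@Sset_saturated X i k d A).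

Lemma Sact_Hset (X : alg C) (i k : C) (d : arr i k) (A : satset T X i) :
  gset_set (Sact d A) = Hset d A.
Proof. exact: Sset_Hset (satset_saturated (s := A)). Qed.

Lemma Sact_id (X : alg C) (i : C) (A : satset T X i) : Sact (idc i) A = A.
Proof. by apply: satset_eq; rewrite Sact_Hset Hset_id. Qed.

Lemma Sact_comp (X : alg C) (i j k : C) (d : arr i j) (e : arr j k)
    (A : satset T X i) : Sact (d ;; e) A = Sact e (Sact d A).
Proof. by apply: satset_eq; rewrite !Sact_Hset Hset_comp. Qed.

Definition Salg (X : alg C) : alg C :=
  @Alg C (satset T X) (@Sact X) (@Sact_id X) (@Sact_comp X).

Lemma Hmap_saturated (X Y : alg C) (h : alg_hom X Y) (i : C)
    (A : satset T X i) : saturated T (Hmap h A).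
Proof.
move=> _ [j2 c2 o2 [k2 y2]] [t1 At1 <-] [/= e [e' [/= E P Q]]].
exists (Triple c2 o2 (IntSum (act X e' (elt (tstate t1))))).
  by apply: satset_saturated At1 _; exists e, e'.
by rewrite /map_triple /= hom_act Q.
Qed.

Definition Smap (X Y : alg C) (h : alg_hom X Y) (i : C) (A : satset T X i) :
    satset T Y i :=
  SatSet (Hmap h A) (@Hmap_saturated X Y h i A).

Lemma Smap_act (X Y : alg C) (h : alg_hom X Y) (i k : C) (d : arr i k)
    (A : satset T X i) : Smap h (Sact d A) = Sact d (Smap h A).
Proof.
apply: satset_eq; rewrite Sact_Hset -[LHS]/(_ @` gset_set (Sact d A)).
by rewrite Sact_Hset Hset_map.
Qed.

Definition Shom (X Y : alg C) (h : alg_hom X Y) : alg_hom (Salg X) (Salg Y) :=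
  @AlgHom C (Salg X) (Salg Y) (@Smap X Y h) (@Smap_act X Y h).

Lemma Shom_id (X : alg C) : Shom (alg_id X) = alg_id (Salg X).
Proof. by apply: alg_hom_eq => i A; apply: satset_eq; exact: map_triple_id. Qed.

Lemma Shom_comp (X Y Z : alg C) (f : alg_hom X Y) (g : alg_hom Y Z) :
  Shom (alg_comp f g) = alg_comp (Shom f) (Shom g).
Proof.
by apply: alg_hom_eq => i A; apply: satset_eq; exact: map_triple_comp.
Qed.

Definition Sfun : endofunctor C := Endofunctor Shom_id Shom_comp.

Lemma S_incl_act (X : alg C) (i j : C) (d : arr i j) (A : Sfun X i) :
  satset_gset (act (Sfun X) d A) = act (Hfun hC O X) d (satset_gset A).
Proof. by apply: gset_eq; exact: Sact_Hset. Qed.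

Definition S_incl (X : alg C) : alg_hom (Sfun X) (Hfun hC O X) :=
  @AlgHom C (Sfun X) (Hfun hC O X) (fun i A => satset_gset A) (@S_incl_act X).

End Sfunctor.
Arguments Sfun {C} hC {O} T.
Arguments S_incl {C} hC {O} T X.

(* Main.v *)
(* If [bangS x = bangS y] then also [bangH x = bangH y], because [bangS]
   followed by the map from F_S, regarded as an H-coalgebra, to F_H is an
   H-coalgebra morphism and so equals [bangH].
   Conversely, the image of an H-coalgebra morphism out of an S_T-coalgebra is
   itself an S_T-coalgebra, since the image of a saturated set is saturated.
   Hence [bangS] factors through the corestriction of [bangH] to its image. *)
Require Import Defs.
From mathcomp Require Import all_boot.
From mathcomp Require Import boolp classical_sets functions cardinality.

Local Open Scope classical_set_scope.

Section ImageAlgebra.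
Context {C : category} {X Z : alg C} (f : alg_hom X Z).

(** A preimage is asserted to exist but is not stored, so by proof irrelevance equality in the image
    is equality in [Z]. *)
Definition image_carrier (i : C) : Type := {z : Z i | exists x, f i x = z}.

Lemma image_carrier_eq {i : C} (z w : image_carrier i) :
  sval z = sval w -> z = w.
Proof. by case: z w => [z zP] [w wP] /= zw; exact: eq_exist. Qed.

Lemma image_act_subproof (i j : C) (c : arr i j) (z : image_carrier i) :
  exists x, f j x = act Z c (sval z).
Proof.
by case: z => z [x xz]; exists (act X c x); rewrite hom_act xz.
Qed.

Definition image_act (i j : C) (c : arr i j) (z : image_carrier i) :
    image_carrier j :=
  exist _ (act Z c (sval z)) (image_act_subproof i j c z).

Lemma image_act_id (i : C) (z : image_carrier i) : image_act i i (idc i) z = z.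
Proof. by apply: image_carrier_eq; exact: act_id. Qed.

Lemma image_act_comp (i j k : C) (d : arr i j) (e : arr j k)
    (z : image_carrier i) :
  image_act i k (compc d e) z = image_act j k e (image_act i j d z).
Proof. by apply: image_carrier_eq; exact: act_comp. Qed.

Definition image_alg : alg C :=
  @Alg C image_carrier image_act image_act_id image_act_comp.

Definition image_corestr_fun (i : C) (x : X i) : image_alg i :=
  exist _ (f i x) (ex_intro _ x erefl).

Lemma image_corestr_act (i j : C) (c : arr i j) (x : X i) :
  image_corestr_fun j (act X c x) = act image_alg c (image_corestr_fun i x).
Proof. by apply: image_carrier_eq; exact: hom_act. Qed.

Definition image_corestr : alg_hom X image_alg :=
  @AlgHom C X image_alg image_corestr_fun image_corestr_act.

Definition image_incl : alg_hom image_alg Z :=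
  @AlgHom C image_alg Z (fun i => sval) (fun i j c x => erefl).

Lemma image_corestr_surj (i : C) (z : image_alg i) :
  exists x, image_corestr i x = z.
Proof. by case: z => z [x xz]; exists x; exact: image_carrier_eq. Qed.

Lemma image_incl_inj (i : C) : injective (image_incl i).
Proof. by move=> z w; exact: image_carrier_eq. Qed.

End ImageAlgebra.

Lemma map_triple_inj {C : category} {O : Type} {X Y : C -> Type}
    {h : forall i, X i -> Y i} {i : C} :
  (forall j, injective (h j)) ->
  injective (map_triple (O := O) h (i := i)).
Proof.
move=> h_inj [j c o [k x]] [j' c' o' [k' x']] e.
(* The target of the arrow and the sort of the state are themselves fields of a triple, so arrows
   and states are compared inside dependent pairs until these objects have been identified. *)
have /= ec := congr1 (fun t => existT (arr i) (tgt t) (tarr t)) e.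
have /= es := congr1 (fun t => existT Y (srt (tstate t)) (elt (tstate t))) e.
have /= ej := congr1 (@projT1 _ _) ec; have /= ek := congr1 (@projT1 _ _) es.
have /= eo := congr1 (fun t => tobs t) e.
subst j' k' o'.
by rewrite (existT_inj_snd ec) (h_inj _ _ _ (existT_inj_snd es)).
Qed.

Lemma Hmap_inj {C : category} {O : Type} {X Y : C -> Type}
    {h : forall i, X i -> Y i} {i : C} :
  (forall j, injective (h j)) -> injective (Hmap (O := O) h (i := i)).
Proof.
move=> h_inj A B /(congr1 (@gset_set _ _ _ _)) /= AB; apply: gset_eq.
have m_inj := map_triple_inj (O := O) (i := i) h_inj.
apply/seteqP; split=> t At.
- have : (map_triple h (i := i) @` B) (map_triple h t) by rewrite -AB; exists t.
  by case=> u Bu /m_inj <-.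
- have : (map_triple h (i := i) @` A) (map_triple h t) by rewrite AB; exists t.
  by case=> u Au /m_inj <-.
Qed.

Section ForgetSaturation.
Context {C : category} {hC : countable [set: arrows C]} {O : Type}
  {T : inference_system C O}.

Definition H_of_S (X : coalg (Sfun hC T)) : coalg (Hfun hC O) :=
  Coalg (coalg_alg X) (alg_comp (coalg_str X) (S_incl hC T X)).

(** Both functors act on arrows by direct image, so the inclusion of $\mathbf{S}_T$ in $\mathbf{H}$
    is natural; composing the square of [f] with it gives the required square. *)
Lemma H_of_S_hom_comm {X Y : coalg (Sfun hC T)} (f : coalg_hom X Y) :
  alg_comp (coalg_str (H_of_S X)) (fmap (Hfun hC O) f)
  = alg_comp (coalg_fun f) (coalg_str (H_of_S Y)).
Proof.
have /(congr1 (fun g => alg_comp g (S_incl hC T Y))) := coalg_hom_comm f.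
by move=> E; apply: alg_hom_eq => i x; have := congr1 (fun g => hom_fun g i x) E.
Qed.

Definition H_of_S_hom {X Y : coalg (Sfun hC T)} (f : coalg_hom X Y) :
    coalg_hom (H_of_S X) (H_of_S Y) :=
  @CoalgHom C _ (H_of_S X) (H_of_S Y) f (H_of_S_hom_comm f).

End ForgetSaturation.

Lemma coalg_comp_comm {C : category} {B : endofunctor C} {X Y Z : coalg B}
    (f : coalg_hom X Y) (g : coalg_hom Y Z) :
  alg_comp (coalg_str X) (fmap B (alg_comp f g))
  = alg_comp (alg_comp f g) (coalg_str Z).
Proof.
rewrite fmap_comp; apply: alg_hom_eq => i x /=.
have /= -> := congr1 (fun h => hom_fun h i x) (coalg_hom_comm f).
exact: (congr1 (fun h => hom_fun h i (f i x)) (coalg_hom_comm g)).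
Qed.

Definition coalg_comp {C : category} {B : endofunctor C} {X Y Z : coalg B}
    (f : coalg_hom X Y) (g : coalg_hom Y Z) : coalg_hom X Z :=
  @CoalgHom C B X Z (alg_comp f g) (coalg_comp_comm f g).

Lemma final_coalg_unique {C : category} {B : endofunctor C} {X F : coalg B}
    (f g : coalg_hom X F) :
  final_coalg F -> f = g.
Proof. by move=> /(_ X) [h hP]; rewrite (hP f) (hP g). Qed.

Section ImageCoalgebra.
Context {C : category} {hC : countable [set: arrows C]} {O : Type}
  {T : inference_system C O} {X : coalg (Sfun hC T)} {Z : coalg (Hfun hC O)}
  (f : coalg_hom (H_of_S X) Z).

Let e : alg_hom X (image_alg f) := image_corestr f.

(* The structure map of [Z] sends [f x] to the direct image of the saturated
   set of [x], and direct image along the inclusion of [image_alg f] is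
   injective. *)
Lemma image_str_well_defined (i : C) (x y : X i) :
  f i x = f i y ->
  Smap e (coalg_str X i x) = Smap e (coalg_str X i y).
Proof.
move=> fxy; apply: satset_eq; congr gset_set.
apply: (Hmap_inj (h := image_incl f)); first exact: image_incl_inj.
have fE z : Hmap (image_incl f) (Hmap e (coalg_str X i z))
    = coalg_str Z i (f i z).
  have /= <- := congr1 (fun h => hom_fun h i z) (coalg_hom_comm f).
  by apply: gset_eq; rewrite /= image_comp.
by rewrite [LHS]fE [RHS]fE fxy.
Qed.

(** An arbitrary choice, with no compatibility with the arrows of [C]; [image_str_well_defined]
    makes the structure map independent of it. *)
Definition image_preimage (i : C) (z : image_alg f i) : X i :=
  sval (cid (image_corestr_surj f i z)).

Definition image_str_fun (i : C) (z : image_alg f i) :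
    Sfun hC T (image_alg f) i :=
  Smap e (coalg_str X i (image_preimage i z)).

Lemma image_str_corestr (i : C) (x : X i) :
  image_str_fun i (e i x) = Smap e (coalg_str X i x).
Proof.
apply: image_str_well_defined; rewrite /image_preimage.
(* The chosen preimage [x'] may differ from [x], but both have the same image under [f]. *)
by case: cid => x' /= /(congr1 sval).
Qed.

(** As [e] is surjective, it suffices to check elements [e i x]. There the structure map is given by
    [coalg_str X] followed by $\mathbf{S}_T(e)$, and both are homomorphisms. *)
Lemma image_str_act (i j : C) (c : arr i j) (z : image_alg f i) :
  image_str_fun j (act (image_alg f) c z)
  = act (Sfun hC T (image_alg f)) c (image_str_fun i z).
Proof.
have [x <-] := image_corestr_surj f i z.
rewrite -hom_act !image_str_corestr hom_act.
exact: (hom_act (Shom hC T e)).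
Qed.

Definition image_coalg : coalg (Sfun hC T) :=
  Coalg (image_alg f)
    (@AlgHom C (image_alg f) (Sfun hC T (image_alg f)) image_str_fun
       image_str_act).

Lemma image_corestr_comm :
  alg_comp (coalg_str X) (fmap (Sfun hC T) e)
  = alg_comp e (coalg_str image_coalg).
Proof. by apply: alg_hom_eq => i x; rewrite /= image_str_corestr. Qed.

Definition image_coalg_corestr : coalg_hom X image_coalg :=
  @CoalgHom C (Sfun hC T) X image_coalg e image_corestr_comm.

End ImageCoalgebra.

Theorem corollaryD8 (C : category) (hC : countable [set: arrows C]) (O : Type)
    (T : inference_system C O)
    (FH : coalg (Hfun hC O)) (FH_final : final_coalg FH)
    (FS : coalg (Sfun hC T)) (FS_final : final_coalg FS)
    (X : alg C) (alpha : alg_hom X (Sfun hC T X))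
    (bangS : coalg_hom (Coalg X alpha) FS)
    (bangH : coalg_hom (Coalg X (alg_comp alpha (S_incl hC T X))) FH)
    (i : C) (x y : X i) :
  bangH i x = bangH i y <-> bangS i x = bangS i y.
Proof.
split=> [xy|xy].
(* The source of [bangH] is convertible to [H_of_S (Coalg X alpha)], the form that the image
   construction expects. *)
- pose f : coalg_hom (H_of_S (Coalg X alpha)) FH := bangH.
  have [g _] := FS_final (image_coalg f).
  rewrite (final_coalg_unique bangS
    (coalg_comp (image_coalg_corestr f) g) FS_final) /=.
  (* [bangS] is now the corestriction of [f] followed by [g], and [xy] says that the corestriction
     identifies [x] and [y]. *)
  by congr (g i _); exact: image_carrier_eq.
- have [g _] := FH_final (H_of_S FS).
  rewrite (final_coalg_unique bangH
    (coalg_comp (H_of_S_hom bangS) g) FH_final) /=.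
  by rewrite xy.
Qed.
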